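(* Let $X$, $Y$ be graphs, let $\varphi:X\to Y$ be a locally surjective homomorphism and let $x\in V_X$. If $x$ is isolated in $X$, then $\varphi(x)$ is isolated in $Y$.
   Context: All graphs are finite, undirected, simple and reflexive: a graph $X=(V_X,E_X)$ has a finite nonempty vertex set $V_X$, and $E_X$ consists of all loops $\{x\}$ ($x\in V_X$; written $\{x,x\}$) together with a (possibly empty) set of $2$-element subsets of $V_X$. A homomorphism $\varphi:X\to Y$ is a map $\varphi:V_X\to V_Y$ such that $\{x_1,x_2\}\in E_X$ implies $\{\varphi(x_1),\varphi(x_2)\}\in E_Y$. $N_X(x)=\{u\in V_X:\{x,u\}\in E_X\}$ (so $x\in N_X(x)$). $\varphi$ is locally surjective if $\varphi(N_X(x))=N_Y(\varphi(x))$ for all $x\in V_X$. A vertex $x$ is isolated in $X$ if the component of $X$ containing $x$ has $x$ as its only vertex. *)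

(* Defs.v *)
From mathcomp Require Import all_boot.

Set Implicit Arguments.
Unset Strict Implicit.
Unset Printing Implicit Defensive.

(* Edges are the one- and two-element sets {x, y}, encoded as a symmetric
   relation; reflexivity says that every loop {x, x} is an edge. *)
Record graph := Graph {
  vertex : finType;
  edge : rel vertex;
  vertex_nonempty : 0 < #|vertex|;
  edge_refl : reflexive edge;
  edge_sym : symmetric edge
}.

Arguments edge : clear implicits.

Definition nbhd (X : graph) (x : vertex X) : {set vertex X} :=
  [set u | edge X x u].

Definition homomorphism (X Y : graph) (phi : vertex X -> vertex Y) : Prop :=
  forall x1 x2 : vertex X, edge X x1 x2 -> edge Y (phi x1) (phi x2).

Definition locally_surjective (X Y : graph) (phi : vertex X -> vertex Y) :
    Prop :=
  forall x : vertex X, phi @: nbhd x = nbhd (phi x).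

Definition component (X : graph) (x : vertex X) : {set vertex X} :=
  [set y | connect (edge X) x y].

Definition isolated (X : graph) (x : vertex X) : Prop :=
  component x = [set x].

(* Main.v *)
Require Import Defs.
From mathcomp Require Import all_boot.

(** Isolation can be read off the closed neighbourhood alone ([isolated_nbhd]), and local
    surjectivity carries neighbourhoods onto neighbourhoods: that of [phi x] is the image of a
    singleton. *)

Lemma isolated_nbhd (X : graph) (x : vertex X) :
  isolated x <-> nbhd x = [set x].
Proof.
split=> [iso_x | nbhd_x].
- apply/eqP; rewrite eqEsubset sub1set inE edge_refl andbT -iso_x.
  by apply/subsetP=> u; rewrite !inE => /connect1.
- apply/eqP; rewrite eqEsubset sub1set inE connect0 andbT.
  apply/subsetP=> y; rewrite !inE => /connectP[p].
  elim: p => [_ -> //|u p IHp /= /andP[xu]].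
  (* A path cannot leave [x]: its first step leads back to [x], so the rest again starts at [x] and
     the induction hypothesis, with [x] fixed, applies. *)
  have /set1P-> : u \in [set x] by rewrite -nbhd_x inE.
  exact: IHp.
Qed.

Theorem corollary5p12 (X Y : graph) (phi : vertex X -> vertex Y)
    (phi_hom : homomorphism phi) (phi_ls : locally_surjective phi)
    (x : vertex X) :
  isolated x -> isolated (phi x).
Proof.
move=> /isolated_nbhd nbhd_x; apply/isolated_nbhd.
by rewrite -phi_ls nbhd_x imset_set1.
Qed.
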